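(* For every integer $n\ge 3$, $q_n=\Xi(n-1)$.
   Context: $T_j=j(j+1)/2$ denotes the $j$-th triangular number. For $n\ge 2$, $\Xi(n)$ denotes the smallest integer $k>0$ such that $T_n+T_k=T_m$ for some integer $m$ (such a $k$ always exists). For $n\ge 3$, let $A(n)$ be the smallest positive integer $k$ such that $n+k+1$ divides $a_n(k):=n+(n+1)+\cdots+(n+k)=(k+1)n+\frac{k(k+1)}{2}$ (such a $k$ exists for all $n\ge 3$). With $k=A(n)$, put $q_n:=\dfrac{a_n(k)}{n+k+1}$. *)

(* Defs.v *)
From mathcomp Require Import all_boot all_order all_algebra.
From mathcomp Require Import boolp.
From mathcomp Require Import zify.

Set Implicit Arguments.
Unset Strict Implicit.
Unset Printing Implicit Defensive.

Local Open Scope nat_scope.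

(* The value is 0 when P has no solution; see leastP for the other case. *)
Definition least (P : nat -> Prop) : nat :=
  if pselect (exists k, `[< P k >]) is left exP then ex_minn exP else 0.

Lemma leastP (P : nat -> Prop) :
  (exists k, P k) -> P (least P) /\ (forall j, P j -> least P <= j).
Proof.
move=> [k Pk]; rewrite /least; case: pselect => [exP|[]]; last first.
  by exists k; apply/asboolP.
case: ex_minnP => m /asboolP Pm min_m; split=> // j Pj.
by apply: min_m; apply/asboolP.
Qed.

(* The division is exact; negative j are allowed, and T (- j - 1) = T j. *)
Definition T (j : int) : int := (j * (j + 1) %/ 2)%Z.

Definition Xi_cond (n k : nat) : Prop :=
  0 < k /\ exists m : int, (T n%:Z + T k%:Z = T m)%R.

Definition Xi (n : nat) : nat := least (Xi_cond n).

Definition a (n k : nat) : nat := \sum_(n <= i < n + k + 1) i.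

Definition A_cond (n k : nat) : Prop := 0 < k /\ n + k + 1 %| a n k.

Definition A (n : nat) : nat := least (A_cond n).

(* For 2 < n the division is exact, by A_ex and leastP. *)
Definition q (n : nat) : nat := a n (A n) %/ (n + A n + 1).

Lemma even_mulS (k : nat) : exists s : nat, k * (k + 1) = s * 2.
Proof.
exists (k * (k + 1))./2; have := odd_double_half (k * (k + 1)).
by rewrite oddM oddD /= addbT andbN; lia.
Qed.

Lemma aE (n k : nat) : a n k = (k + 1) * n + (k * (k + 1)) %/ 2.
Proof.
rewrite /a; elim: k => [|k IHk].
  by rewrite addn0 addn1 big_nat1 mul0n add0n mul1n div0n addn0.
have [s Es] := even_mulS k.
have -> : k.+1 * (k.+1 + 1) = (s + k + 1) * 2 by nia.
have -> : n + k.+1 + 1 = (n + k + 1).+1 by lia.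
rewrite big_nat_recr /=; last by lia.
by rewrite IHk Es !mulnK //; nia.
Qed.

Lemma Xi_ex (n : nat) : 1 < n -> exists k, Xi_cond n k.
Proof.
move=> n_gt1; have [t Et] := even_mulS n.
have t_gt1 : 1 < t by nia.
exists t.-1; split; first by lia.
exists (Posz t); rewrite /T.
have [s Es] := even_mulS t.-1.
by nia.
Qed.

Lemma A_ex (n : nat) : 2 < n -> exists k, A_cond n k.
Proof.
move=> n_gt2; have [m ->] : exists m, n = m + 3 by exists (n - 3); lia.
exists (m * m + 4 * m + 2); split; first by lia.
rewrite aE; set k := m * m + 4 * m + 2.
have [s Es] := even_mulS k; rewrite Es mulnK //.
have [u Eu] : exists u, (m + 1) * (m + 4) = u * 2.
  have [u Eu] := even_mulS (m + 1); exists (u + m + 1); nia.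
apply/dvdnP; exists u; rewrite /k in Es *.
have /eqP : (m + 1) * (m + 4) * ((m + 3) * (m + 2)) = u * 2 * ((m + 3) * (m + 2)).
  by rewrite Eu.
nia.
Qed.

(* Main.v *)
Require Import Defs.
From mathcomp Require Import all_boot all_order all_algebra.
From mathcomp Require Import zify.

(** Write [M = n + k] for the last term of the sum [a n k = T_M - T_(n-1)].
    The equation [a n k = q * (M + 1)] says the same as the factorization
    [n * (n - 1) = (M + 1) * (M - 2 * q)] ([sum_quotientE]).  With [m = M - q]
    the right-hand side is [(m + q + 1) * (m - q) = 2 * (T_m - T_q)], so the
    same equation also says [T_(n-1) + T_q = T_m] ([triangular_sumE]).  Hence
    the admissible [k] for [A n] and the admissible values for [Xi (n - 1)]
    correspond to each other through [k |-> a n k / (n + k + 1)], with inverse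
    [q |-> m + q - n], where [m] is chosen nonnegative, as [T_opp] permits.

    It remains to see that the two minima match.  The two factors [M + 1] and
    [M - 2 * q] have a constant positive product, so when [M] grows the second
    factor shrinks, and therefore [q], which is half of [M] minus that factor,
    grows with [M] ([quotient_le]).  The smallest [k] gives the smallest [q]. *)

Set Implicit Arguments.
Unset Strict Implicit.
Unset Printing Implicit Defensive.

Local Open Scope ring_scope.

Lemma double_T (j : int) : T j * 2 = j * (j + 1).
Proof.
rewrite /T divzK //; apply/dvdzP.
have [[u ->]|[u ->]] : (exists u : int, j = u * 2) \/ (exists u : int, j = u * 2 + 1).
  have := divz_eq j 2; have : (0 <= (j %% 2)%Z < 2) by lia.
  move=> r_bound Ej; have [r0|r1] : (j %% 2)%Z = 0 \/ (j %% 2)%Z = 1 by lia.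
    by left; exists (j %/ 2)%Z; lia.
  by right; exists (j %/ 2)%Z; lia.
- by exists (u * (u * 2 + 1)); nia.
- by exists ((u * 2 + 1) * (u + 1)); nia.
Qed.

Lemma T_opp (j : int) : T (- j - 1) = T j.
Proof. by have := double_T (- j - 1); have := double_T j; nia. Qed.

Lemma sum_quotientE (n k s : nat) : (0 < n)%N ->
  a n k = (s * (n + k + 1))%N <->
  (n%:Z + k%:Z + 1) * (n%:Z + k%:Z - 2 * s%:Z) = n%:Z * (n%:Z - 1).
Proof.
move=> n_gt0; have [t Et] := even_mulS k.
by rewrite aE Et mulnK //; split=> H; nia.
Qed.

Lemma triangular_sumE (n s : nat) (m : int) : (0 < n)%N ->
  T (n - 1)%N%:Z + T s%:Z = T m <->
  (m + s%:Z + 1) * (m - s%:Z) = n%:Z * (n%:Z - 1).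
Proof.
move=> n_gt0.
have -> : (n - 1)%N%:Z = n%:Z - 1 by lia.
have := double_T (n%:Z - 1); have := double_T s%:Z; have := double_T m.
by move=> Em Es En; split=> H; nia.
Qed.

Lemma Xi_cond_quotient (n k s : nat) : (1 < n)%N ->
  a n k = (s * (n + k + 1))%N -> Xi_cond (n - 1) s.
Proof.
move=> n_gt1 Ea; have a_gt0 : (0 < a n k)%N by rewrite aE; nia.
split; first by case: s Ea => // Ea; lia.
exists (n%:Z + k%:Z - s%:Z); apply/triangular_sumE; first by lia.
move/sum_quotientE: Ea => Ea; rewrite -Ea; last by lia.
by congr (_ * _); lia.
Qed.

Lemma quotient_of_Xi_cond (n s : nat) : (1 < n)%N -> Xi_cond (n - 1) s ->
  exists2 k, (0 < k)%N & a n k = (s * (n + k + 1))%N.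
Proof.
move=> n_gt1 [s_gt0 [m0 Em0]].
have [m m_ge0 Em] : exists2 m : int, 0 <= m & T (n - 1)%N%:Z + T s%:Z = T m.
  have [m0_ge0|m0_lt0] : 0 <= m0 \/ m0 < 0 by lia.
    by exists m0.
  by exists (- m0 - 1); [lia | rewrite T_opp].
move/triangular_sumE: Em => /(_ (ltnW n_gt1)) Em.
(* As s is positive, (n - 1) * n < m * (m + 1), and k = m + s - n > 0. *)
have n_le_m : n%:Z <= m by nia.
exists (`|m|%N + s - n)%N; first by lia.
apply/sum_quotientE; first by lia.
by rewrite -Em; congr (_ * _); lia.
Qed.

(** Both pairs factor the same positive number [n * (n - 1)]: a larger first
    factor [n + k' + 1] forces a smaller second factor [n + k' - 2 * s']. *)
Lemma quotient_le (n k k' s s' : nat) : (1 < n)%N ->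
  a n k = (s * (n + k + 1))%N -> a n k' = (s' * (n + k' + 1))%N ->
  (k <= k')%N -> (s <= s')%N.
Proof.
move=> n_gt1 /sum_quotientE E /sum_quotientE E' le_kk'.
have {}E := E (ltnW n_gt1); have {}E' := E' (ltnW n_gt1).
rewrite leqNgt; apply/negP => lt_s's.
have d_gt0 : 0 < n%:Z + k%:Z - 2 * s%:Z by nia.
have lt_d : n%:Z + k%:Z - 2 * s%:Z < n%:Z + k'%:Z - 2 * s'%:Z by lia.
by nia.
Qed.

Local Close Scope ring_scope.

Theorem theorem2p4 (n : nat) (hn : 3 <= n) : q n = Xi (n - 1).
Proof.
have n_gt1 : (1 < n)%N by lia.
have [[_ dvd_a] A_min] := leastP (A_ex hn).
have Eq : a n (A n) = (q n * (n + A n + 1))%N by rewrite /q divnK.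
have [Xi_sol Xi_min] : Xi_cond (n - 1) (Xi (n - 1)) /\
    (forall j, Xi_cond (n - 1) j -> Xi (n - 1) <= j)%N.
  by apply: leastP; apply: Xi_ex; lia.
have [k k_gt0 Ek] := quotient_of_Xi_cond n_gt1 Xi_sol.
apply/eqP; rewrite eqn_leq (Xi_min _ (Xi_cond_quotient n_gt1 Eq)) andbT.
apply: (quotient_le n_gt1 Eq Ek (A_min _ _)).
by split=> //; rewrite Ek dvdn_mull.
Qed.
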